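(* For all $r\ge 2$ and $\ell\in\{2,3,5\}$, $$\mathrm{ex}\left(n,\{TC^r_{r+1},TC^r_{r+2},\ldots,TC^r_{\ell r}\}\right)=\Omega\left(n^{r-1+1/\ell}\right).$$
   Context: An $r$-graph is an $r$-uniform hypergraph. For integers $r<k$, the tight $k$-cycle $TC^r_k$ is the $r$-graph on vertices $u_0,\ldots,u_{k-1}$ with edges $\{u_i,u_{i+1},\ldots,u_{i+r-1}\}$ for $0\le i<k$, indices modulo $k$. For a family $\mathcal{F}$ of $r$-graphs, $\mathrm{ex}(n,\mathcal{F})$ is the maximum number of edges in an $n$-vertex $r$-graph containing no member of $\mathcal{F}$ as a subgraph. *)

(* Defs.v *)
From HB Require Import structures.
From mathcomp Require Import all_boot all_order all_algebra.
From mathcomp Require Import all_classical all_reals all_analysis.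

Set Implicit Arguments.
Unset Strict Implicit.
Unset Printing Implicit Defensive.

(* A hypergraph on the finite vertex type V is given by its set of edges;
   it is an r-graph when it is r-uniform. *)
Definition uniform (r : nat) (V : finType) (G : {set {set V}}) : bool :=
  [forall e in G, #|e| == r].

(* Non-induced subgraphs, up to isomorphism. *)
Definition contains (V W : finType) (G : {set {set V}}) (H : {set {set W}})
  : bool :=
  [exists f : {ffun W -> V},
     injectiveb f && [forall e in H, [set f w | w in e] \in G]].

(* A hypergraph with vertex set 'I_k, packaged with its order k. *)
Definition hypergraph : Type := {k : nat & {set {set 'I_k}}}.

Definition family_free (V : finType) (F : seq hypergraph)
    (G : {set {set V}}) : bool :=
  all (fun H : hypergraph => ~~ contains G (tagged H)) F.

Definition ex_num (r n : nat) (F : seq hypergraph) : nat :=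
  \max_(G : {set {set 'I_n}} | uniform r G && family_free F G) #|G|.

Definition tight_cycle (r k : nat) : {set {set 'I_k}} :=
  [set [set u : 'I_k | [exists j : 'I_r, u == i + j %[mod k]]] | i : 'I_k].

Lemma tight_cycle_uniform (r k : nat) : r <= k -> uniform r (tight_cycle r k).
Proof.
move=> rk; apply/'forall_implyP => e /imsetP[i _ ->].
have k0 : 0 < k by apply: leq_ltn_trans (ltn_ord i).
pose g (j : 'I_r) : 'I_k := Ordinal (ltn_pmod (i + j) k0).
have ginj : injective g.
  move=> j j' /(congr1 val) /= /eqP; rewrite eqn_modDl.
  rewrite !modn_small ?(leq_trans (ltn_ord _) rk) //.
  by move=> /eqP /val_inj.
rewrite -[X in _ == X](card_ord r) -(card_imset _ ginj); apply/eqP.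
apply: eq_card => u; rewrite inE; apply/existsP/imsetP.
- case=> j; rewrite (modn_small (ltn_ord u)) => /eqP uj.
  by exists j => //; apply: val_inj.
- by case=> j _ ->; exists j; rewrite /= modn_mod.
Qed.

(* The list TC^r_{r+1}, TC^r_{r+2}, ..., TC^r_m. *)
Definition tight_cycles (r m : nat) : seq hypergraph :=
  [seq existT (fun k : nat => {set {set 'I_k}}) k (tight_cycle r k)
     | k <- index_iota r.+1 m.+1].

(* Main.v *)
Require Import Defs.
From mathcomp Require Import all_boot all_order all_algebra all_field.
From mathcomp Require Import all_classical all_reals all_analysis.
From mathcomp Require Import ring zify.

Import Order.TTheory GRing.Theory Num.Theory.
Import numFieldNormedType.Exports.
Local Open Scope ring_scope.

(** Over F = GF(3^m) with q elements, put W = F^(l-1) and let kappa (b, a) in W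
    be the first l-1 monomials among ab, a^2 b, a^3 b, a^3 b^2.  Consider the
    r-partite r-graph with parts F x W whose edges are the transversals with
    (sum of the W-coordinates) - kappa (b, a) = B, where b and a are the
    F-coordinates in two distinguished parts; by pigeonhole some B gives at
    least q^(l(r-1)+1) edges on r q^l vertices.
    A tight cycle visits the parts periodically, so its length is r t, and
    advancing it by one vertex does not change the sum of the W-coordinates
    over the other r-2 parts.  Hence the two distinguished parts trace a closed
    non-backtracking walk of length 2t in a bipartite graph
    v + w = kappa (b, a) + const.  This graph has girth more than 2l; for l = 5
    this needs characteristic 3, where the commutator subgroup of the unipotent
    group of G_2 is abelian and the graph is modelled on the big cell of the
    split Cayley hexagon. *)

(** * Short closed walks in the monomial bipartite graph *)

(** A closed walk of length 10 on vertices b_i, a_i, normalised so that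
    a_0 = b_1 = 0.  Cut it at a_0, b_1 and at a_3, b_3: the two halves have the
    same moments m_1, m_2, m_3, n, but [Phi] of the moments is the product of
    the steps on the half that begins with a step of a, and 0 on the other. *)
Lemma char3_decagon (F : fieldType) (h3 : 3%:R = 0 :> F)
    (a1 a2 a3 a4 b0 b2 b3 b4 : F) :
  (forall j, (j < 3)%N ->
    a1 ^+ j.+1 * b2 + a2 ^+ j.+1 * (b3 - b2) + a3 ^+ j.+1 * (b4 - b3)
    + a4 ^+ j.+1 * (b0 - b4) = 0) ->
  a1 ^+ 3 * b2 ^+ 2 + a2 ^+ 3 * (b3 ^+ 2 - b2 ^+ 2)
    + a3 ^+ 3 * (b4 ^+ 2 - b3 ^+ 2) + a4 ^+ 3 * (b0 ^+ 2 - b4 ^+ 2) = 0 ->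
  a1 * b2 * (a2 - a1) ^+ 2 * (b3 - b2) * (a3 - a2) = 0.
Proof.
move=> rel reln.
pose Phi (m1 m2 m3 n : F) :=
  m2 ^+ 2 - m1 * m3 + a3 * (n + m1 * m2 - 2%:R * b3 * m3).
pose mL j := a1 ^+ j * b2 + a2 ^+ j * (b3 - b2).
pose mR j := a3 ^+ j * (b3 - b4) + a4 ^+ j * (b4 - b0).
pose nL := a1 ^+ 3 * b2 ^+ 2 + a2 ^+ 3 * (b3 ^+ 2 - b2 ^+ 2).
pose nR := a3 ^+ 3 * (b3 ^+ 2 - b4 ^+ 2) + a4 ^+ 3 * (b4 ^+ 2 - b0 ^+ 2).
have mE j : (j < 3)%N -> mL j.+1 = mR j.+1.
  by move=> /rel r; apply/eqP; rewrite -subr_eq0 -r /mL /mR; apply/eqP; ring.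
have nE : nL = nR.
  by apply/eqP; rewrite -subr_eq0 -reln /nL /nR; apply/eqP; ring.
have PhiL : Phi (mL 1) (mL 2) (mL 3) nL
    = a1 * b2 * (a2 - a1) ^+ 2 * (b3 - b2) * (a3 - a2)
      + 3%:R * (a3 * b2 * (b3 - b2) * a1 ^+ 2 * (a2 - a1)).
  by rewrite /Phi /mL /nL; ring.
have PhiR : Phi (mR 1) (mR 2) (mR 3) nR
    = 3%:R * (a3 * (b4 - b0) * (b3 - b4) * a4 ^+ 2 * (a3 - a4)).
  by rewrite /Phi /mR /nR; ring.
by move: PhiL; rewrite !mE // nE PhiR h3 !mul0r addr0.
Qed.

Definition wenger_exps : seq (nat * nat) :=
  [:: (1, 1); (2, 1); (3, 1); (3, 2)]%N.

Definition wenger (F : fieldType) (m : nat) (b a : F) : 'rV[F]_m :=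
  \row_i let e := nth (0, 0)%N wenger_exps i in a ^+ e.1 * b ^+ e.2.
Arguments wenger {F}.

(** Equality of the sums gives relations between [a] and the steps of [b], and a combination of them
    is a product of nonzero steps. The monomial ab settles [t = 2], adding a^2 b settles [t = 3],
    and all four settle [t = 4] and [t = 5]. *)
Lemma wenger_no_closed_walk (F : fieldType) (h3 : 3%:R = 0 :> F) (l t : nat)
    (a b : nat -> F) :
  l \in [:: 2; 3; 5]%N -> (2 <= t <= l)%N -> a t = a 0 -> b t = b 0 ->
  (forall i, a i != a i.+1) -> (forall i, b i != b i.+1) ->
  \sum_(i < t) wenger l.-1 (b i) (a i)
    <> \sum_(i < t) wenger l.-1 (b i.+1) (a i).
Proof.
move=> hl /andP[t2 tl] at0 bt0 da db hs.
have rel e : e \in take l.-1 wenger_exps ->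
    \sum_(i < t) a i ^+ e.1 * (b i.+1 ^+ e.2 - b i ^+ e.2) = 0.
  move=> /(nthP (0, 0)%N)[j]; rewrite size_take_min leq_min => /andP[jl _].
  rewrite nth_take // => <-; under eq_bigr do rewrite mulrBr.
  rewrite sumrB; apply/eqP; rewrite subr_eq0; apply/eqP; symmetry.
  have /rowP/(_ (Ordinal jl)) := hs; rewrite !summxE.
  by under eq_bigr do rewrite mxE; under [RHS]eq_bigr do rewrite mxE.
have sub_neq0 (x y : F) : x != y -> (y - x == 0) = false.
  by rewrite subr_eq0 eq_sym => /negPf.
have [t_eq2|t_eq3|t_gt3] : [\/ t = 2%N, t = 3%N | (3 < t)%N].
- have [t3|t3|->] := ltngtP t 3; [constructor 1|constructor 3|constructor 2] => //.
  by apply/eqP; rewrite eqn_leq t2 andbT -ltnS.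
- have r11 : a 0 * (b 1 - b 0) + a 1 * (b 0 - b 1) = 0.
    rewrite -[RHS](rel (1, 1)%N); last by case: (l) (leq_trans t2 tl) => [|[|?]].
    by rewrite t_eq2 !big_ord_recl big_ord0 addr0 -{2}bt0 t_eq2.
  have /eqP : (a 1 - a 0) * (b 1 - b 0) = 0 by rewrite -oppr0 -r11; ring.
  by rewrite mulf_eq0 !sub_neq0.
- have l3 : (2 < l)%N by rewrite -t_eq3.
  have l5 e : e \in take 2 wenger_exps -> e \in take l.-1 wenger_exps.
    move=> he; apply: (@mem_take 2).
    by rewrite take_takel //; case: (l) l3.
  have sum3 e : e \in take 2 wenger_exps -> a 0 ^+ e.1 * (b 1 ^+ e.2 - b 0 ^+ e.2)
      + a 1 ^+ e.1 * (b 2 ^+ e.2 - b 1 ^+ e.2)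
      + a 2 ^+ e.1 * (b 0 ^+ e.2 - b 2 ^+ e.2) = 0.
    move=> /l5/rel; rewrite t_eq3 !big_ord_recl big_ord0 addr0 addrA => <-.
    by rewrite -{2}bt0 t_eq3.
  have /= r11 := sum3 (1, 1)%N isT; have /= r21 := sum3 (2, 1)%N isT.
  (* The steps of [b] sum to 0, so this combination weights the step at [a i] by -(a i - a 1)(a i -
     a 2), which vanishes unless i = 0. *)
  have /eqP : (a 1 - a 0) * (a 0 - a 2) * (b 1 - b 0) = 0.
    transitivity (- (a 0 ^+ 2 * (b 1 ^+ 1 - b 0 ^+ 1)
      + a 1 ^+ 2 * (b 2 ^+ 1 - b 1 ^+ 1) + a 2 ^+ 2 * (b 0 ^+ 1 - b 2 ^+ 1))
      + (a 1 + a 2) * (a 0 ^+ 1 * (b 1 ^+ 1 - b 0 ^+ 1)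
      + a 1 ^+ 1 * (b 2 ^+ 1 - b 1 ^+ 1) + a 2 ^+ 1 * (b 0 ^+ 1 - b 2 ^+ 1))).
      by ring.
    by rewrite r11 r21 mulr0 oppr0 addr0.
  have := da 2; rewrite -t_eq3 at0 => da2.
  by rewrite !mulf_eq0 !sub_neq0.
- have l5 : l = 5%N by move: hl tl t_gt3; rewrite !inE => /or3P[] /eqP-> //; lia.
  (* A walk of length 8 is padded by b 4 = b 0, which kills the last term. *)
  have sum5 e : e \in wenger_exps ->
      a 0 ^+ e.1 * (b 1 ^+ e.2 - b 0 ^+ e.2)
      + a 1 ^+ e.1 * (b 2 ^+ e.2 - b 1 ^+ e.2)
      + a 2 ^+ e.1 * (b 3 ^+ e.2 - b 2 ^+ e.2)
      + a 3 ^+ e.1 * (b 4 ^+ e.2 - b 3 ^+ e.2)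
      + a 4 ^+ e.1 * (b 0 ^+ e.2 - b 4 ^+ e.2) = 0.
    move=> he; have := rel e; rewrite l5 => /(_ he) <-.
    have [t5|t4] : t = 5%N \/ t = 4%N by lia.
      by rewrite t5 !big_ord_recl big_ord0 addr0 !addrA -{2}bt0 t5.
    rewrite t4 !big_ord_recl big_ord0 addr0 !addrA.
    have -> : b 4 = b 0 by rewrite -bt0 t4.
    by rewrite subrr mulr0 addr0.
  have /= := sum5 (1, 1)%N isT; have /= := sum5 (2, 1)%N isT.
  have /= := sum5 (3, 1)%N isT; have /= := sum5 (3, 2)%N isT.
  rewrite !expr1.
  set r32 := (X in X = 0) => r32_0; set r31 := (X in X = 0) => r31_0.
  set r21 := (X in X = 0) => r21_0; set r11 := (X in X = 0) => r11_0.
  (* Cubing is additive in characteristic 3, so translating [a] by [a 0] preserves the relations in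
     a^3. *)
  have cube (x y : F) : (x - y) ^+ 3 = x ^+ 3 - y ^+ 3.
    have -> : (x - y) ^+ 3 = x ^+ 3 - y ^+ 3 + 3%:R * (x * y * (y - x)) by ring.
    by rewrite h3 mul0r addr0.
  (* Only indices up to 3 occur, so every factor is a genuine step even when the walk is padded. *)
  have /eqP : (a 1 - a 0) * (b 2 - b 1) * (a 2 - a 1) ^+ 2
      * (b 3 - b 2) * (a 3 - a 2) = 0.
    transitivity ((a 1 - a 0) * (b 2 - b 1) * ((a 2 - a 0) - (a 1 - a 0)) ^+ 2
      * ((b 3 - b 1) - (b 2 - b 1)) * ((a 3 - a 0) - (a 2 - a 0))); first by ring.
    apply: (@char3_decagon F h3 _ _ _ (a 4 - a 0) (b 0 - b 1) _ _ (b 4 - b 1)).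
      case=> [|[|[|//]]] _.
      - by rewrite -r11_0 /r11; ring.
      - by transitivity (r21 - 2%:R * a 0 * r11);
          [rewrite /r21 /r11; ring | rewrite r21_0 r11_0; ring].
      - rewrite !cube; transitivity r31 => //; rewrite /r31; ring.
    rewrite !cube; transitivity (r32 - 2%:R * b 1 * r31).
      by rewrite /r32 /r31; ring.
    by rewrite r32_0 r31_0; ring.
  by rewrite !mulf_eq0 !sub_neq0.
Qed.

(** * Colourings with [r] colours in which every window of length [r] is rainbow *)

Lemma rainbow_inj {r : nat} {p : nat -> 'I_r} :
  (forall w c, exists2 j, (j < r)%N & p (w + j)%N = c) ->
  forall w i j, (i < r)%N -> (j < r)%N -> p (w + i)%N = p (w + j)%N -> i = j.
Proof.
move=> surj w i j ir jr pij.
pose q (k : 'I_r) := p (w + k)%N.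
have /imset_injP q_inj : #|q @: 'I_r| == #|'I_r|.
  rewrite -(cardsT 'I_r); apply/eqP; congr #|pred_of_set _|; apply/setP => c.
  by rewrite inE; have [k kr <-] := surj w c; apply/imsetP; exists (Ordinal kr).
by have /(congr1 val) := q_inj (Ordinal ir) (Ordinal jr) isT isT pij.
Qed.

(** The window after [i] contains the colour of [i]; injectivity on the window starting at [i]
    leaves only position [i + r] for it. *)
Lemma rainbow_periodic {r : nat} {p : nat -> 'I_r} :
  (forall w c, exists2 j, (j < r)%N & p (w + j)%N = c) ->
  forall i, p (i + r)%N = p i.
Proof.
move=> surj i; have [j jr pj] := surj i.+1 (p i).
have [jr1|] := boolP (j.+1 == r); first by rewrite -pj addSnnS (eqP jr1).
move=> jr1; have {jr1}jr : (j.+1 < r)%N by rewrite ltn_neqAle jr1.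
have := rainbow_inj surj i j.+1 0 jr (leq_ltn_trans (leq0n _) jr).
by rewrite addn0 -addSnnS => /(_ pj).
Qed.

Lemma rainbow_dvd {r k : nat} {p : nat -> 'I_r} :
  (forall w c, exists2 j, (j < r)%N & p (w + j)%N = c) ->
  p k = p 0%N -> (r %| k)%N.
Proof.
move=> surj pk; have r0 : (0 < r)%N by apply: leq_ltn_trans (ltn_ord (p 0%N)).
have per m i : p (i + m * r)%N = p i.
  by elim: m => [|m IH]; rewrite ?addn0 // mulSnr addnA rainbow_periodic.
apply/eqP; apply: (rainbow_inj surj 0); rewrite ?ltn_pmod //.
by rewrite !add0n -pk [in RHS](divn_eq k r) addnC per.
Qed.

(** * From tight cycles to closed walks *)

Definition defect {F : fieldType} {m r : nat} (c0 c1 : 'I_r)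
    (x : 'I_r -> F * 'rV[F]_m) : 'rV[F]_m :=
  \sum_j (x j).2 - wenger m (x c0).1 (x c1).1.

(** Here [v] is a tight cycle unrolled to a sequence of period [k], and [x w] is the edge on the
    window starting at [w], read as a choice of one vertex in each part. *)
Lemma no_tight_walk (F : fieldType) (h3 : 3%:R = 0 :> F) (l r k : nat)
    (c0 c1 : 'I_r) (B : 'rV[F]_l.-1) (v : nat -> 'I_r * (F * 'rV[F]_l.-1))
    (x : nat -> 'I_r -> F * 'rV[F]_l.-1) :
  l \in [:: 2; 3; 5]%N -> (r < k <= l * r)%N -> c0 != c1 ->
  (forall w j, (j < r)%N -> (v (w + j)%N).2 = x w (v (w + j)%N).1) ->
  (forall w c, exists2 j, (j < r)%N & (v (w + j)%N).1 = c) ->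
  (forall w, defect c0 c1 (x w) = B) ->
  (forall i, v (i + k)%N = v i) -> (forall i, v (i + r)%N != v i) -> False.
Proof.
move=> hl /andP[rk klr] c01 hv surj hB vk vr.
pose p i := (v i).1.
have p_per i : p (i + r)%N = p i := rainbow_periodic surj i.
have p_perM m i : p (i + m * r)%N = p i.
  by elim: m => [|m IH]; rewrite ?addn0 // mulSnr addnA p_per.
have /dvdnP[t kE] : (r %| k)%N.
  by apply: (rainbow_dvd (p := p) surj); exact: (congr1 fst (vk 0%N)).
have r0 : (0 < r)%N by apply: leq_ltn_trans (ltn_ord c0).
have tl : (2 <= t <= l)%N.
  by move: rk klr; rewrite kE -{1}[r]mul1n ltn_pmul2r // leq_pmul2r // => -> ->.
(* Consecutive windows differ by one vertex leaving and one entering, both in part [p w]. *)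
have agree w d : d != p w -> x w.+1 d = x w d.
  have [j jr <-] := surj w.+1 d => dw.
  have jr1 : (j.+1 < r)%N.
    rewrite ltn_neqAle jr andbT; apply: contra dw => /eqP jr1.
    have -> : (w.+1 + j = w + r)%N by lia.
    by rewrite -[(v _).1]/(p (w + r)%N) p_per.
  by rewrite -hv // addSnnS hv.
(* Exchanging the vertex in part [p w] changes only coordinates inside [S],
   or only coordinates outside it. *)
pose S w := (x w c0).2 + (x w c1).2 - wenger l.-1 (x w c0).1 (x w c1).1.
have S_const w : S w = S 0%N.
  elim: w => // w <-.
  have [pw|] := boolP ((p w == c0) || (p w == c1)); last first.
    rewrite negb_or => /andP[p0 p1].
    by rewrite /S !agree // eq_sym.
  have defectE u : S u = B - \sum_(j | (j != c0) && (j != c1)) (x u j).2.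
    rewrite -(hB u) /defect [in RHS](bigD1 c0) //= (bigD1 c1) 1?eq_sym //=.
    by rewrite addrA [RHS]addrAC addrK.
  rewrite !defectE; congr (_ - _); apply: eq_bigr => j /andP[j0 j1].
  by rewrite agree //; case/orP: pw => /eqP->.
(* The walk starts at a position [s] in part [c0]; [c] is the offset to the next position in part
   [c1]. *)
have [s _ ps] := surj 0%N c0; have [c cr pc] := surj s c1.
rewrite add0n in ps.
have c_gt0 : (0 < c)%N.
  by rewrite lt0n; apply: contra c01 => /eqP c_0; rewrite -ps -pc c_0 addn0.
pose A i := (s + i * r)%N.
have AS i : A i.+1 = (A i + r)%N by rewrite /A mulSn; lia.
have pA i : p (A i) = c0 by rewrite /A p_perM.
have pAc i : p (A i + c)%N = c1 by rewrite /A addnAC p_perM.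
(* The window at [A i] contains [A i] and [A i + c], the one at [A i + c] contains [A i + c] and
   [A i.+1]: these are two successive edges of the bipartite walk. *)
have x0 i : x (A i) c0 = (v (A i)).2.
  by rewrite -(pA i) -{3}[A i]addn0 hv // addn0.
have x1 i : x (A i) c1 = (v (A i + c)%N).2 by rewrite hv // -/(p _) pAc.
have x0' i : x (A i + c)%N c0 = (v (A i.+1)).2.
  have -> : A i.+1 = (A i + c + (r - c))%N by rewrite AS; lia.
  rewrite hv ?ltn_subrL ?c_gt0 //; congr (x _ _).
  by rewrite -/(p _) -(pA i.+1) AS; congr p; lia.
have x1' i : x (A i + c)%N c1 = (v (A i + c)%N).2.
  by rewrite -(pAc i) -{3}[(A i + c)%N]addn0 hv // addn0.
pose b i := (v (A i)).2.1; pose a i := (v (A i + c)%N).2.1.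
pose b2 i := (v (A i)).2.2; pose a2 i := (v (A i + c)%N).2.2.
have eqn1 i : wenger l.-1 (b i) (a i) = b2 i + a2 i - S 0%N.
  by rewrite -(S_const (A i)) /S x0 x1 opprB addrC subrK.
have eqn2 i : wenger l.-1 (b i.+1) (a i) = b2 i.+1 + a2 i - S 0%N.
  by rewrite -(S_const (A i + c)%N) /S x0' x1' opprB addrC subrK.
have At : A t = (A 0 + k)%N by rewrite kE /A mul0n addn0.
apply: (@wenger_no_closed_walk F h3 l t a b) => //.
- by rewrite /a At addnAC vk.
- by rewrite /b At vk.
(* Both vertices are adjacent to the one at [A i.+1], so equal first coordinates force equal
   vertices, at positions [r] apart. *)
- move=> i; apply/eqP => ai.
  have a2i : a2 i = a2 i.+1.
    have := eqn2 i; rewrite ai eqn1 => /addIr /addrI; exact: esym.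
  have /eqP[] := vr (A i + c)%N; rewrite addnAC -AS.
  apply: injective_projections; first by rewrite -!/(p _) !pAc.
  by apply: injective_projections; apply: esym.
- move=> i; apply/eqP => bi.
  have b2i : b2 i = b2 i.+1.
    by have := eqn2 i; rewrite -bi eqn1 => /addIr /addIr.
  have /eqP[] := vr (A i); rewrite -AS.
  apply: injective_projections; first by rewrite -!/(p _) !pA.
  by apply: injective_projections; apply: esym.
- under eq_bigr do rewrite eqn1; under [RHS]eq_bigr do rewrite eqn2.
  rewrite !sumrB !big_split /=; congr (_ + _ - _).
  have b2t : b2 t = b2 0%N by rewrite /b2 At vk.
  have := erefl (\sum_(i < t.+1) b2 i).
  by rewrite {1}big_ord_recr big_ord_recl /= b2t addrC => /addrI.
Qed.

(** * The r-partite construction *)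

Definition tag_edge {r : nat} {Z : finType} (x : {ffun 'I_r -> Z}) :
    {set 'I_r * Z} := [set (c, x c) | c : 'I_r].

Lemma in_tag_edge (r : nat) (Z : finType) (x : {ffun 'I_r -> Z}) u :
  (u \in tag_edge x) = (u.2 == x u.1).
Proof.
case: u => c z /=; apply/imsetP/eqP => [[d _ [-> ->]] // | ->].
by exists c.
Qed.

Lemma tag_edge_inj (r : nat) (Z : finType) : injective (@tag_edge r Z).
Proof.
move=> x y /setP exy; apply/ffunP => c; apply/eqP.
by have := exy (c, x c); rewrite !in_tag_edge eqxx => <-.
Qed.

Lemma card_tag_edge (r : nat) (Z : finType) (x : {ffun 'I_r -> Z}) :
  #|tag_edge x| = r.
Proof. by rewrite card_imset ?card_ord // => c d []. Qed.

Definition defect_graph {F : finFieldType} {m r : nat} (c0 c1 : 'I_r)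
    (B : 'rV[F]_m) : {set {set 'I_r * (F * 'rV[F]_m)}} :=
  [set tag_edge x | x : {ffun 'I_r -> F * 'rV[F]_m} & defect c0 c1 x == B].

Lemma defect_graph_card (F : finFieldType) (m r : nat) (c0 c1 : 'I_r) :
  exists B : 'rV[F]_m,
    ((#|F| ^ m.+1) ^ r <= #|defect_graph c0 c1 B| * #|F| ^ m)%N.
Proof.
pose E (B : 'rV[F]_m) :=
  [set x : {ffun 'I_r -> F * 'rV[F]_m} | defect c0 c1 x == B].
have cardE B : #|defect_graph c0 c1 B| = #|E B|.
  by rewrite card_imset //; exact: tag_edge_inj.
have sumE : (\sum_B #|E B| = (#|F| ^ m.+1) ^ r)%N.
  transitivity #|{ffun 'I_r -> F * 'rV[F]_m}|; last first.
    by rewrite card_ffun card_prod card_mx mul1n -expnS card_ord.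
  rewrite -sum1_card.
  rewrite (partition_big (fun x : {ffun _ -> _} => defect c0 c1 x) predT) //=.
  by apply: eq_bigr => B _; rewrite -sum1_card; apply: eq_bigl => x; rewrite inE.
apply/existsP; apply: contraT; rewrite negb_exists => /forallP small.
(* If every class fell short, summing over all [B] would lose at least 1 per class against the total
   count. *)
have : (\sum_(B : 'rV[F]_m) (#|E B| * #|F| ^ m + 1)
    <= \sum_(B : 'rV[F]_m) (#|F| ^ m.+1) ^ r)%N.
  by apply: leq_sum => B _; rewrite addn1 -cardE ltnNge.
rewrite big_split -big_distrl /= sumE !sum_nat_const muln1 card_mx mul1n.
rewrite mulnC -[X in (_ <= X)%N]addn0 leq_add2l leqNgt expn_gt0.
by rewrite (cardD1 0) inE.
Qed.

Lemma defect_graph_no_tight (F : finFieldType) (h3 : 3%:R = 0 :> F)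
    (l r n k : nat) (c0 c1 : 'I_r) (B : 'rV[F]_l.-1)
    (h : 'I_r * (F * 'rV[F]_l.-1) -> 'I_n) :
  injective h -> l \in [:: 2; 3; 5]%N -> (r < k <= l * r)%N -> c0 != c1 ->
  ~~ contains [set h @: (e : {set _}) | e in defect_graph c0 c1 B]
      (tight_cycle r k).
Proof.
move=> h_inj hl rkl c01; have /andP[rk _] := rkl.
have r0 : (0 < r)%N by apply: leq_ltn_trans (ltn_ord c0).
have k0 : (0 < k)%N := ltn_trans r0 rk.
apply/negP => /existsP[f /andP[/injectiveP f_inj /forall_inP f_edge]].
pose idx w : 'I_k := Ordinal (ltn_pmod w k0).
pose e (i : 'I_k) := [set u : 'I_k | [exists j : 'I_r, u == i + j %[mod k]]].
have /fin_all_exists[X hX] i : exists x : {ffun 'I_r -> F * 'rV[F]_l.-1},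
    defect c0 c1 x = B /\ [set f w | w in e i] = h @: tag_edge x.
  have /f_edge : e i \in tight_cycle r k by apply: imset_f.
  case/imsetP => y /imsetP[x]; rewrite inE => /eqP xB -> ->.
  by exists x.
(* Each vertex of the cycle lies in an edge, hence in the image of [h], and can be pulled back. *)
have /fin_all_exists[g hg] i : exists u, f i = h u.
  have [_ /setP/(_ (f i))] := hX i.
  have -> : f i \in [set f w | w in e i].
    apply/imset_f; rewrite inE; apply/existsP; exists (Ordinal r0).
    by rewrite addn0.
  by move/esym/imsetP => [u _ ->]; exists u.
have g_inj : injective g by move=> i j gij; apply: f_inj; rewrite !hg gij.
have in_e w j : (j < r)%N -> idx (w + j)%N \in e (idx w).
  move=> jr; rewrite inE; apply/existsP; exists (Ordinal jr) => /=.
  by rewrite modn_mod modnDml.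
apply: (@no_tight_walk F h3 l r k c0 c1 B (g \o idx) (fun w => X (idx w))) => //=.
- move=> w j jr; have [_ /setP/(_ (f (idx (w + j)%N)))] := hX (idx w).
  rewrite imset_f ?in_e // hg mem_imset // in_tag_edge.
  by move/esym/eqP.
- move=> w c; have [_ /setP/(_ (h (c, X (idx w) c)))] := hX (idx w).
  rewrite [RHS]mem_imset // in_tag_edge eqxx => /imsetP[u].
  rewrite inE => /existsP[j /eqP uj]; rewrite hg => /h_inj cu.
  exists j => //; suff -> : idx (w + j)%N = u by rewrite -cu.
  by apply: val_inj; rewrite /= -modnDml -uj modn_small.
- by move=> w; have [] := hX (idx w).
- by move=> i; congr g; apply: val_inj; rewrite /= modnDr.
(* Since 0 < r < k, positions [i] and [i + r] differ modulo [k]. *)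
- move=> i; apply/eqP => /g_inj/(congr1 val)/eqP /=.
  by rewrite -{2}[i]addn0 eqn_modDl mod0n modn_small // eqn0Ngt r0.
Qed.

(** With q = [#|F|], the q^(lr) transversals fall into q^(l-1) classes, which gives the exponent
    l(r-1) + 1. The surplus vertices of ['I_n] stay isolated. *)
Lemma ex_num_ge (F : finFieldType) (h3 : 3%:R = 0 :> F) (l r n : nat) :
  l \in [:: 2; 3; 5]%N -> (2 <= r)%N -> (r * #|F| ^ l <= n)%N ->
  (#|F| ^ (l * r.-1).+1 <= ex_num r n (tight_cycles r (l * r)))%N.
Proof.
move=> hl r2 rn.
have l0 : (0 < l)%N by case: l hl {rn}.
have cardV : #|{: 'I_r * (F * 'rV[F]_l.-1)}| = (r * #|F| ^ l)%N.
  by rewrite !card_prod card_mx mul1n -expnS prednK // card_ord.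
pose c0 : 'I_r := Ordinal (ltnW r2); pose c1 : 'I_r := Ordinal r2.
have [B hB] := @defect_graph_card F l.-1 r c0 c1.
rewrite -cardV in rn.
pose h (u : 'I_r * (F * 'rV[F]_l.-1)) : 'I_n := widen_ord rn (enum_rank u).
have h_inj : injective h by move=> u u' /(congr1 val) /= /val_inj /enum_rank_inj.
apply: (@leq_trans #|[set h @: (e : {set _}) | e in defect_graph c0 c1 B]|).
  rewrite card_imset; last exact: imset_inj.
  have q0 : (0 < #|F|)%N by apply/card_gt0P; exists 0.
  rewrite -(@leq_pmul2r (#|F| ^ l.-1)) ?expn_gt0 ?q0 //; apply: leq_trans hB.
  rewrite -expnD -expnM prednK // leq_pexp2l //.
  have -> : r = r.-1.+1 by rewrite prednK // ltnW.
  have -> : l = l.-1.+1 by rewrite prednK.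
  by rewrite /=; lia.
apply: (@leq_bigmax_cond _ _ (fun G : {set {set 'I_n}} => #|G|)).
apply/andP; split.
  apply/forall_inP => _ /imsetP[_ /imsetP[x _ ->] ->].
  by rewrite card_imset // card_tag_edge.
apply/allP => H /mapP[k]; rewrite mem_index_iota ltnS => rk ->.
exact: defect_graph_no_tight.
Qed.

(** * Choice of the field and asymptotics *)

(** Take the largest q = 3^m with q^l at most n/r; maximality costs a factor 3^l, and the lower
    bound on [n] ensures m > 0. *)
Lemma exists_field_order (l r n : nat) :
  (0 < r)%N -> (0 < l)%N -> (r * 3 ^ l <= n)%N ->
  exists F : finFieldType,
    [/\ 3%:R = 0 :> F, (r * #|F| ^ l <= n)%N & (n <= r * 3 ^ l * #|F| ^ l)%N].
Proof.
move=> r0 l0 rn.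
have c1 : (1 < 3 ^ l)%N by rewrite -(expn0 3) ltn_exp2l.
have cn : (3 ^ l <= n %/ r)%N by rewrite leq_divRL // mulnC.
have n0 : (0 < n %/ r)%N by apply: leq_trans cn; apply: ltnW.
set m := trunc_log (3 ^ l) (n %/ r).
have m0 : (0 < m)%N by rewrite trunc_log_gt0 c1 prednK // ltnW.
have [F charF cardF] := @pPrimePowerField 3 m isT m0.
have Fl : (#|F| ^ l = (3 ^ l) ^ m)%N by rewrite cardF -!expnM mulnC.
exists F; split; first exact: pcharf0.
  by rewrite Fl mulnC -leq_divRL // trunc_logP.
rewrite -mulnA Fl -expnS mulnC; apply: ltnW; rewrite -ltn_divLR //.
exact: trunc_log_ltn.
Qed.

Local Open Scope classical_set_scope.

Theorem theorem1p7 (R : realType) (r l : nat) (hr : (2 <= r)%N)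
    (hl : l \in [:: 2; 3; 5]%N) :
  (fun n : nat => (ex_num r n (tight_cycles r (l * r)))%:R : R^o) \is
    'Omega_\oo (fun n : nat => n%:R `^ (r%:R - 1 + l%:R^-1) : R^o).
Proof.
have l0 : (0 < l)%N by case: l hl.
have r0 : (0 < r)%N := ltnW hr.
set s : R := r%:R - 1 + l%:R^-1.
have s0 : 0 <= s by rewrite addr_ge0 ?invr_ge0 ?ler0n // subr_ge0 ler1n.
(* Hence (q^l)^s is exactly the edge count q^(l(r-1)+1). *)
have lsE : l%:R * s = (l * r.-1).+1%:R.
  rewrite /s mulrDr divff ?pnatr_eq0 ?lt0n_neq0 // -natr1 natrM.
  by rewrite -[in LHS](prednK r0) -natr1 addrK.
(* [K] is the [s]-th power of the factor by which [n] may exceed q^l. *)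
set K : R := (r * 3 ^ l)%:R `^ s.
have K0 : 0 < K by rewrite powR_gt0 // ltr0n muln_gt0 r0 expn_gt0.
rewrite qualifE; apply/asboolP; exists K^-1; rewrite ?invr_gt0 //.
exists (r * 3 ^ l)%N => // n /= rn.
have [F [h3 Fn nF]] := @exists_field_order l r n r0 l0 rn.
rewrite !ger0_norm ?powR_ge0 ?ler0n // ler_pdivrMl //.
apply: (@le_trans _ _ (K * (#|F| ^ (l * r.-1).+1)%:R)); last first.
  by rewrite ler_pM2l // ler_nat ex_num_ge.
rewrite natrX -powR_mulrn ?ler0n // -lsE powRrM powR_mulrn ?ler0n // -natrX.
rewrite -powRM ?ler0n // -natrM.
by rewrite ge0_ler_powR ?nnegrE ?ler0n // ler_nat.
Qed.
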